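(* Let $T$ be a coherent theory and $\lhd_T$ the relation defined below. Then $\lhd_T$ is a saturated coverage on each of the categories $\mathbb{C}_{\mathrm{rn}},\mathbb{C}_{\mathrm{vs}},\mathbb{C}_{\mathrm{ts}}$, and it is a basis for a Grothendieck topology on $\mathbb{C}_{\mathrm{vs}}$.
   Context: Signature $\Sigma$ single-sorted without equality; $\mathrm{Tm}(X)$ terms over variables $X$. Conditions $(X;A)$: $X$ finite set of variables, $A$ finite set of atoms over $X$. $\mathbb{C}_{\mathrm{ts}}$: morphisms $f:(Y;B)\to(X;A)$ are maps $f:X\to\mathrm{Tm}(Y)$ with $Af\subseteq B$ (postfix substitution, diagram-order composition); $\mathbb{C}_{\mathrm{vs}}$: those sending variables to variables; $\mathbb{C}_{\mathrm{rn}}$: injective ones. ($\mathbb{C}_{\mathrm{vs}}$ has finite limits.) Coherent theory $T$: axioms $\forall\vec x.(\phi_0\to\exists\vec x_1.\phi_1\lor\dots\lor\exists\vec x_k.\phi_k)$, $\phi_i$ finite conjunctions of atoms. $C\lhd_T U$ (also $U\rhd C$), $U$ a set of morphisms with codomain $C$, is inductively generated by: (a) $(X;A)\lhd_T\{f\}$ for every isomorphism $f$ with codomain $(X;A)$; (b) if $\phi_0\to\exists\vec x_1.\phi_1\lor\dots\lor\exists\vec x_n.\phi_n$ is an instance of an axiom of $T$ (terms of $\mathrm{Tm}(X)$ substituted for universal variables) with atoms of $\phi_0$ in $A$, $\vec x_i$ fresh for $X$, and $(X,\vec x_i;A,\phi_i)\lhd_T U_i$ for $i=1..n$, then $(X;A)\lhd_T\bigcup_ie_iU_i$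 where $e_i:(X,\vec x_i;A,\phi_i)\to(X;A)$ is the identity on $X$ and $e_iU_i=\{e_i\circ g\mid g\in U_i\}$. A sink $U$ refines $V$ if every member of $U$ factors through some member of $V$. A saturated coverage is a relation $\lhd$ such that: (i) $C\lhd\{f\}$ for every isomorphism $f$ with codomain $C$; (ii') if $C\lhd U$ and $g:D\to C$, there is $V\rhd D$ with $gV$ refining $U$; (iii) if $C\lhd U$ and $D\lhd V_f$ for each $f:D\to C$ in $U$, then $C\lhd\bigcup_{f\in U}fV_f$. A basis (on a category with finite limits) satisfies (i), (iii) and (ii): if $C\lhd U$ and $g:D\to C$ then $D\lhd\{g^*f\mid f\in U\}$, $g^*f$ the pullback of $f$ along $g$. *)

(* Defs.v *)
From mathcomp Require Import all_boot.
From mathcomp Require Import finmap boolp classical_sets cardinality.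

Set Implicit Arguments.
Unset Strict Implicit.
Unset Printing Implicit Defensive.

Local Open Scope classical_set_scope.

Record category := Category {
  obj :> Type;
  hom : obj -> obj -> Type;
  idm : forall c, hom c c;
  comp : forall c d e, hom d e -> hom c d -> hom c e;
  comp1m : forall c d (f : hom c d), comp (idm d) f = f;
  compm1 : forall c d (f : hom c d), comp f (idm c) = f;
  compA : forall b c d e (f : hom d e) (g : hom c d) (h : hom b c),
    comp f (comp g h) = comp (comp f g) h
}.

Arguments idm {_} c.
Arguments comp {_ c d e} f g.

Declare Scope cat_scope.
Delimit Scope cat_scope with cat.
Notation "f '\oc' g" := (comp f g) (at level 50, left associativity) : cat_scope.
Local Open Scope cat_scope.

Definition isom (C : category) (c d : C) (f : hom c d) : Prop :=
  exists g : hom d c, f \oc g = idm d /\ g \oc f = idm c.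

Record functor (J C : category) := Functor {
  fobj :> J -> C;
  fmap : forall i j, hom i j -> hom (fobj i) (fobj j);
  fmap1 : forall i, fmap (idm i) = idm (fobj i);
  fmapM : forall i j k (u : hom j k) (v : hom i j),
    fmap (u \oc v) = fmap u \oc fmap v
}.

Definition cone (J C : category) (F : functor J C) (c : C)
    (p : forall j, hom c (F j)) : Prop :=
  forall i j (u : hom i j), fmap F u \oc p i = p j.

Definition is_limit (J C : category) (F : functor J C) (c : C)
    (p : forall j, hom c (F j)) : Prop :=
  cone p /\
  forall (d : C) (q : forall j, hom d (F j)), cone q ->
    exists! h : hom d c, forall j, p j \oc h = q j.

Definition finite_category (J : category) : Prop :=
  finite_set [set: J] /\ forall i j : J, finite_set [set: hom i j].

Definition has_finite_limits (C : category) : Prop :=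
  forall J, finite_category J -> forall F : functor J C,
    exists (c : C) (p : forall j, hom c (F j)), is_limit p.

Record pullback (C : category) (c d e : C) (g : hom d c) (f : hom e c) :=
  Pullback {
    pb_obj : C;
    pb_base : hom pb_obj d;
    pb_top : hom pb_obj e;
    pb_comm : g \oc pb_base = f \oc pb_top;
    pb_univ : forall (z : C) (a : hom z d) (b : hom z e), g \oc a = f \oc b ->
      exists! h : hom z pb_obj, pb_base \oc h = a /\ pb_top \oc h = b
  }.

Record arrow_to (C : category) (c : C) := ArrowTo {
  dom : C;
  arr :> hom dom c
}.

Definition sink (C : category) (c : C) := set (arrow_to c).

Definition postcomp (C : category) (c d : C) (f : hom d c) (g : arrow_to d) :
  arrow_to c := ArrowTo (f \oc arr g).

Definition postcomp_sink (C : category) (c d : C) (f : hom d c) (V : sink d) :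
  sink c := postcomp f @` V.

Definition refines (C : category) (c : C) (U V : sink c) : Prop :=
  forall f, U f -> exists g, V g /\ exists h : hom (dom f) (dom g),
    arr f = arr g \oc h.

Definition cov_rel (C : category) := forall c : C, sink c -> Prop.

Definition cov_isom (C : category) (cov : cov_rel C) : Prop :=
  forall (c : C) (f : arrow_to c), isom f -> cov c [set f].

Definition cov_refine (C : category) (cov : cov_rel C) : Prop :=
  forall (c : C) (U : sink c), cov c U -> forall (d : C) (g : hom d c),
    exists V : sink d, cov d V /\ refines (postcomp_sink g V) U.

(* Only the values of [V] on members of [U] matter. *)
Definition cov_trans (C : category) (cov : cov_rel C) : Prop :=
  forall (c : C) (U : sink c) (V : forall f : arrow_to c, sink (dom f)),
    cov c U -> (forall f, U f -> cov (dom f) (V f)) ->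
    cov c (\bigcup_(f in U) postcomp_sink f (V f)).

(* Pullbacks are determined up to isomorphism only, so stability is required
   for every choice [pb] of pullbacks along [g]. *)
Definition cov_pullback (C : category) (cov : cov_rel C) : Prop :=
  forall (c : C) (U : sink c), cov c U -> forall (d : C) (g : hom d c)
    (pb : forall f : arrow_to c, pullback g f),
    cov d [set ArrowTo (pb_base (pb f)) | f in U].

Definition saturated_coverage (C : category) (cov : cov_rel C) : Prop :=
  [/\ cov_isom cov, cov_refine cov & cov_trans cov].

Definition basis (C : category) (cov : cov_rel C) : Prop :=
  has_finite_limits C /\ [/\ cov_isom cov, cov_pullback cov & cov_trans cov].

Record signature := Signature {
  fsym : Type;
  farity : fsym -> nat;
  psym : Type;
  parity : psym -> nat
}.

Inductive term (S : signature) (V : Type) : Type :=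
| Var of V
| App (f : fsym S) of ('I_(farity f) -> term S V).
Arguments Var {S V} _.
Arguments App {S V} f _.

Record atom (S : signature) (V : Type) := Atom {
  apred : psym S;
  aargs : 'I_(parity apred) -> term S V
}.
Arguments Atom {S V} apred aargs.
Arguments aargs {S V} a i.

Section Subst.
Variable S : signature.

Fixpoint tsubst V W (s : V -> term S W) (t : term S V) : term S W :=
  match t with
  | Var v => s v
  | App f ts => App f (fun i => tsubst s (ts i))
  end.

Definition asubst V W (s : V -> term S W) (a : atom S V) : atom S W :=
  Atom (apred a) (fun i => tsubst s (aargs a i)).

Lemma tsubst_var V (t : term S V) : tsubst Var t = t.
Proof. by elim: t => //= f ts IH; congr App; apply/funext. Qed.

Lemma tsubst_comp V W Z (s : V -> term S W) (r : W -> term S Z) (t : term S V) :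
  tsubst r (tsubst s t) = tsubst (fun v => tsubst r (s v)) t.
Proof. by elim: t => //= f ts IH; congr App; apply/funext. Qed.

Lemma asubst_var V (a : atom S V) : asubst Var a = a.
Proof.
by case: a => p ts; congr Atom; apply/funext => i; rewrite /= tsubst_var.
Qed.

Lemma asubst_comp V W Z (s : V -> term S W) (r : W -> term S Z) (a : atom S V) :
  asubst r (asubst s a) = asubst (fun v => tsubst r (s v)) a.
Proof.
by case: a => p ts; congr Atom; apply/funext => i; rewrite /= tsubst_comp.
Qed.

Record atoms (V : Type) := Atoms {
  atom_set :> set (atom S V);
  atom_fin : finite_set atom_set
}.

Definition atoms_subst V W (s : V -> term S W) (A : atoms V) : atoms W :=
  Atoms (finite_image (asubst s) (atom_fin A)).

Lemma atomsU_fin V (A B : atoms V) : finite_set (A `|` B).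
Proof. by rewrite finite_setU; split; apply: atom_fin. Qed.

Definition atomsU V (A B : atoms V) : atoms V := Atoms (atomsU_fin A B).

End Subst.

(* Variables are natural numbers; for [X : {fset nat}], [term S X] is Tm(X). *)
Record condition (S : signature) := Condition {
  cvars : {fset nat};
  catoms : atoms S cvars
}.

Variant kind := Rn | Vs | Ts.

Section Conditions.
Variable S : signature.

Definition to_vars V W (s : V -> term S W) : Prop :=
  forall v, exists w, s v = Var w.

Definition admissible (k : kind) V W (s : V -> term S W) : Prop :=
  match k with
  | Ts => True
  | Vs => to_vars s
  | Rn => to_vars s /\ injective s
  end.

Lemma admissible_var k V W (r : V -> W) :
  injective r -> admissible k (fun v => Var (r v) : term S W).
Proof.
have tv : to_vars (fun v => Var (r v) : term S W) by move=> v; exists (r v).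
by move=> r_inj; case: k => //=; split=> // v w [/r_inj].
Qed.

Lemma admissible_comp k V W Z (s : V -> term S W) (r : W -> term S Z) :
  admissible k s -> admissible k r -> admissible k (fun v => tsubst r (s v)).
Proof.
have tv (s' : V -> term S W) (r' : W -> term S Z) :
    to_vars s' -> to_vars r' -> to_vars (fun v => tsubst r' (s' v)).
  by move=> sv rv v; have [w ->] := sv v; apply: rv.
case: k => //=; last exact: tv.
case=> sv s_inj [rv r_inj]; split; first exact: tv.
move=> v v'; have [w e] := sv v; have [w' e'] := sv v'.
rewrite e e' /= => /r_inj eww; apply: s_inj.
by rewrite e e' eww.
Qed.

(* A morphism from [D] to [C] substitutes terms over [D] for the variables
   of [C]. *)
Record cond_hom (k : kind) (D C : condition S) := CondHom {
  csub : cvars C -> term S (cvars D);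
  csub_adm : admissible k csub;
  csub_atoms : asubst csub @` catoms C `<=` catoms D
}.
Arguments csub {k D C} f x : rename.
Arguments csub_adm {k D C} f : rename.
Arguments csub_atoms {k D C} f : rename.

Lemma cond_homP k (D C : condition S) (f g : cond_hom k D C) :
  csub f = csub g -> f = g.
Proof.
case: f g => [f fa fA] [g ga gA] /= e; move: fa fA; rewrite e => fa fA.
by congr CondHom; apply: Prop_irrelevance.
Qed.

Lemma cond_id_atoms (C : condition S) : asubst Var @` catoms C `<=` catoms C.
Proof. by move=> _ [a Ca <-]; rewrite asubst_var. Qed.

Definition cond_id k (C : condition S) : cond_hom k C C :=
  CondHom (admissible_var k (@inj_id (cvars C))) (@cond_id_atoms C).

Lemma cond_comp_atoms k (B C D : condition S)
    (f : cond_hom k C D) (g : cond_hom k B C) :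
  asubst (fun x => tsubst (csub g) (csub f x)) @` catoms D `<=` catoms B.
Proof.
move=> _ [a Da <-]; rewrite -asubst_comp; apply: (csub_atoms g).
by exists (asubst (csub f) a) => //; apply: (csub_atoms f); exists a.
Qed.

Definition cond_comp k (B C D : condition S)
    (f : cond_hom k C D) (g : cond_hom k B C) : cond_hom k B D :=
  CondHom (admissible_comp (csub_adm f) (csub_adm g)) (@cond_comp_atoms k B C D f g).

Lemma cond_comp1m k (C D : condition S) (f : cond_hom k C D) :
  cond_comp (cond_id k D) f = f.
Proof. exact: cond_homP. Qed.

Lemma cond_compm1 k (C D : condition S) (f : cond_hom k C D) :
  cond_comp f (cond_id k C) = f.
Proof. by apply: cond_homP; apply/funext => x /=; rewrite tsubst_var. Qed.

Lemma cond_compA k (A B C D : condition S)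
    (f : cond_hom k C D) (g : cond_hom k B C) (h : cond_hom k A B) :
  cond_comp f (cond_comp g h) = cond_comp (cond_comp f g) h.
Proof. by apply: cond_homP; apply/funext => x /=; rewrite tsubst_comp. Qed.

Definition cond_cat (k : kind) : category :=
  Category (@cond_comp1m k) (@cond_compm1 k) (@cond_compA k).

End Conditions.

Definition C_rn (S : signature) : category := cond_cat S Rn.
Definition C_vs (S : signature) : category := cond_cat S Vs.
Definition C_ts (S : signature) : category := cond_cat S Ts.

(* The axiom  forall x_0 ... x_(n-1), prem -> \/_(i < k) exists y_0 ... y_(m_i - 1),
   concl i,  with n = [univ], k = [ndisj], m_i = [exis i]; [inl] stands for a
   universal variable, [inr] for an existential one, so axioms are taken up to
   renaming of bound variables. *)
Record coherent_axiom (S : signature) := CoherentAxiom {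
  univ : nat;
  prem : atoms S 'I_univ;
  ndisj : nat;
  exis : 'I_ndisj -> nat;
  concl : forall i, atoms S ('I_univ + 'I_(exis i))
}.

Definition coherent_theory (S : signature) := set (coherent_axiom S).

Section Extension.
Variable S : signature.

Definition fresh (X : {fset nat}) m (y : 'I_m -> nat) : Prop :=
  injective y /\ forall j, y j \notin X.

Definition ext_vars (X : {fset nat}) m (y : 'I_m -> nat) : {fset nat} :=
  (X `|` [fset y j | j in 'I_m])%fset.

Definition old_var (X : {fset nat}) m (y : 'I_m -> nat) (x : X) : ext_vars X y :=
  fincl (fsubsetUl X [fset y j | j in 'I_m]%fset) x.

Lemma new_var_subproof (X : {fset nat}) m (y : 'I_m -> nat) j : y j \in ext_vars X y.
Proof. by rewrite in_fsetU in_imfset ?orbT. Qed.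

Definition new_var (X : {fset nat}) m (y : 'I_m -> nat) (j : 'I_m) : ext_vars X y :=
  [` new_var_subproof X y j]%fset.

(* The instance of a disjunct: [s] on universal variables, the names [y] for
   the existential ones. *)
Definition inst (X : {fset nat}) n m (s : 'I_n -> term S X) (y : 'I_m -> nat)
    (v : 'I_n + 'I_m) : term S (ext_vars X y) :=
  match v with
  | inl i => tsubst (fun x => Var (old_var y x)) (s i)
  | inr j => Var (new_var X y j)
  end.

(* (X, y; A, phi[s, y]) for C = (X; A). *)
Definition ext_cond (C : condition S) n m (s : 'I_n -> term S (cvars C))
    (y : 'I_m -> nat) (phi : atoms S ('I_n + 'I_m)) : condition S :=
  Condition (atomsU (atoms_subst (fun x => Var (old_var y x)) (catoms C))
                    (atoms_subst (inst s y) phi)).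

Lemma old_var_inj (X : {fset nat}) m (y : 'I_m -> nat) : injective (@old_var X m y).
Proof. by move=> x x' /(congr1 val) e; apply: val_inj. Qed.

Definition ext_proj k (C : condition S) n m (s : 'I_n -> term S (cvars C))
    (y : 'I_m -> nat) (phi : atoms S ('I_n + 'I_m)) :
  @hom (cond_cat S k) (ext_cond s y phi) C :=
  @CondHom S k (ext_cond s y phi) C (fun x => Var (old_var y x))
    (admissible_var S k (@old_var_inj _ _ y)) (@subsetUl _ _ _).

End Extension.

Inductive cov (S : signature) (T : coherent_theory S) (k : kind) :
  forall C : cond_cat S k, sink C -> Prop :=
| cov_of_isom (C : cond_cat S k) (f : arrow_to C) :
    isom f -> cov T [set f]
| cov_of_axiom (C : cond_cat S k) (ax : coherent_axiom S)
    (s : 'I_(univ ax) -> term S (cvars C))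
    (y : forall i : 'I_(ndisj ax), 'I_(exis i) -> nat)
    (U : forall i, @sink (cond_cat S k) (ext_cond s (y i) (concl i))) :
    T ax ->
    atoms_subst s (prem ax) `<=` catoms C ->
    (forall i, fresh (cvars C) (y i)) ->
    (forall i, cov T (U i)) ->
    cov T (\bigcup_i postcomp_sink (ext_proj k s (y i) (concl i)) (U i)).

(* Main.v *)
(* A morphism g : D -> C carries an axiom instance over C to one over D, and
   lifts to the extensions by the disjuncts once fresh names are chosen over D.
   Induction on covers then gives refinement.  In the isomorphism case of
   transitivity the cover itself must be pushed forward along an isomorphism,
   which works because an isomorphism g lifts to isomorphisms of extensions.  On
   C_vs the lifting squares are pullbacks, so stability follows from the pasting
   lemma; limits there are computed as finite colimits of the sets of
   variables. *)
From mathcomp Require Import all_boot.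
From mathcomp Require Import finmap boolp classical_sets cardinality.
Require Import Defs.

Set Implicit Arguments.
Unset Strict Implicit.
Unset Printing Implicit Defensive.

Local Open Scope classical_set_scope.
Local Open Scope cat_scope.

(** * Isomorphisms, sinks and pullbacks in an arbitrary category *)

Section Category.
Variable C : category.

Lemma isom_idm (c : C) : isom (idm c).
Proof. by exists (idm c); rewrite comp1m. Qed.

Lemma isom_comp (c d e : C) (f : hom d e) (g : hom c d) :
  isom f -> isom g -> isom (f \oc g).
Proof.
move=> [f' [ff' f'f]] [g' [gg' g'g]]; exists (g' \oc f'); split.
- by rewrite compA -(compA f) gg' compm1.
- by rewrite compA -(compA g') f'f compm1.
Qed.

Lemma postcomp_sinkM (c d e : C) (f : hom d e) (g : hom c d) (V : sink c) :
  postcomp_sink (f \oc g) V = postcomp_sink f (postcomp_sink g V).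
Proof.
by rewrite /postcomp_sink image_comp; congr (_ @` _); apply/funext => h /=;
  rewrite /postcomp /= compA.
Qed.

Lemma postcomp_sink_bigcup I (P : set I) (c d : C) (f : hom c d)
    (V : I -> sink c) :
  postcomp_sink f (\bigcup_(i in P) V i) = \bigcup_(i in P) postcomp_sink f (V i).
Proof. exact: image_bigcup. Qed.

(** Carries a refinement found over an extension down along the lifting square. *)
Lemma refines_square (c d c' d' : C) (g : hom d c) (e : hom c' c)
    (g' : hom d' c') (e' : hom d' d) (V : sink d') (U : sink c') :
  e \oc g' = g \oc e' -> refines (postcomp_sink g' V) U ->
  refines (postcomp_sink g (postcomp_sink e' V)) (postcomp_sink e U).
Proof.
move=> sq ref _ [_ [v Vv <-] <-].
have [|f [Uf [h /= vE]]] := ref (postcomp g' v); first by exists v.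
exists (postcomp e f); split; first by exists f.
by exists h; rewrite /= compA -sq -!compA vE.
Qed.

Lemma isom_pb_base (c d e : C) (g : hom d c) (f : hom e c)
  (P : pullback g f) : isom f -> isom (pb_base P).
Proof.
(* The inverse is induced by the identity and [f' \oc g]. *)
case=> f' [ff' f'f]; have [|h [[h1 h2] _]] := pb_univ P (a := idm d) (b := f' \oc g).
  by rewrite compm1 compA ff' comp1m.
exists h; split=> //.
have [k [_ uk]] := pb_univ P (pb_comm P).
rewrite -(uk (h \oc pb_base P)) ?(uk (idm _)) ?compm1 //.
rewrite !compA h1 comp1m h2; split=> //.
by rewrite -compA pb_comm compA f'f comp1m.
Qed.

(** The base of the given [P] is recovered on the nose, domain included, so that stability under an
    arbitrary choice of pullbacks can be proved by induction. *)
Lemma pullback_paste (c d e b : C) (g : hom d c) (f : hom e c)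
    (Q : pullback g f) (u : hom b e) (P : pullback g (f \oc u)) :
  exists R : pullback (pb_top Q) u,
    ArrowTo (pb_base Q \oc pb_base R) = ArrowTo (pb_base P).
Proof.
have [|k [[k1 k2] _]] := pb_univ Q (a := pb_base P) (b := u \oc pb_top P).
  by rewrite pb_comm compA.
have kU z (a : hom z (pb_obj Q)) (v : hom z b) : pb_top Q \oc a = u \oc v ->
    exists! h, k \oc h = a /\ pb_top P \oc h = v.
  move=> av; have [|h [[h1 h2] hU]] := pb_univ P (a := pb_base Q \oc a) (b := v).
    by rewrite compA pb_comm -compA av compA.
  exists h; split=> [|h' [h'1 h'2]]; last first.
    by apply: hU; rewrite -h'1 compA k1.
  (* Uniqueness in [Q] makes its legs jointly monic, which forces [k \oc h = a]. *)
  split=> //; have [|l [_ lU]] := pb_univ Q (a := pb_base Q \oc a)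
    (b := pb_top Q \oc a); first by rewrite !compA pb_comm.
  rewrite -(lU a) // (lU (k \oc h)) // !compA k1 k2 h1 av.
  by rewrite -compA h2.
by exists (Pullback k2 kU); rewrite /= k1.
Qed.

End Category.

(** * Extensions by fresh variables and their universal property *)

Section Extension.
Variable S : signature.

Lemma Var_inj V (v v' : V) : Var v = Var v' :> term S V -> v = v'.
Proof. by case. Qed.

Lemma csub_atom k (D C : condition S) (f : @hom (cond_cat S k) D C)
    (s : cvars C -> term S (cvars D)) (p : atom S (cvars C)) :
  csub f =1 s -> atom_set (catoms C) p -> atom_set (catoms D) (asubst s p).
Proof. by move=> /funext <- Cp; apply: csub_atoms; exists p. Qed.

Lemma exists_fresh (X : {fset nat}) m : exists y : 'I_m -> nat, fresh X y.
Proof.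
exists (fun j => (\max_(x <- X) x).+1 + j)%N; split=> [j j' /addnI/val_inj //|j].
apply/negP => jX; have := leq_bigmax_seq (F := id) (P := xpredT) _ jX isT.
by rewrite addSn ltnNge leq_addr.
Qed.

Lemma ext_varsP (X : {fset nat}) m (y : 'I_m -> nat) (v : ext_vars X y) :
  (exists x, v = old_var y x) \/ (exists j, v = new_var X y j).
Proof.
have := valP v; rewrite in_fsetU => /orP[vX|/imfsetP[j _ vj]].
- by left; exists [` vX]%fset; apply: val_inj.
- by right; exists j; apply: val_inj.
Qed.

Lemma old_new_var (X : {fset nat}) m (y : 'I_m -> nat) (x : X) j :
  fresh X y -> old_var y x <> new_var X y j.
Proof.
by move=> [_ /(_ j) yj] /(congr1 val) /= e; move: yj; rewrite -e (valP x).
Qed.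

Lemma new_var_inj (X : {fset nat}) m (y : 'I_m -> nat) :
  fresh X y -> injective (new_var X y).
Proof. by move=> [yI _] j j' /(congr1 val) /= /yI. Qed.

(** Freshness makes [ext_vars X y] the disjoint union of [X] and ['I_m]; [h] is the copairing. *)
Lemma ext_copair (X : {fset nat}) m (y : 'I_m -> nat) W (a : X -> W)
    (b : 'I_m -> W) : fresh X y ->
  exists h : ext_vars X y -> W,
    (forall x, h (old_var y x) = a x) /\ (forall j, h (new_var X y j) = b j).
Proof.
move=> yX; suff /choice[h hP] : forall v : ext_vars X y, exists w,
    (forall x, v = old_var y x -> w = a x) /\
    (forall j, v = new_var X y j -> w = b j).
  by exists h; split=> [x|j]; [apply: (hP _).1|apply: (hP _).2].
move=> v; have [[x ->]|[j ->]] := ext_varsP v.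
- by exists (a x); split=> [x' /old_var_inj ->|j /(old_new_var yX)].
- by exists (b j); split=> [x /esym/(old_new_var yX)|j' /(new_var_inj yX) ->].
Qed.

Variable k : kind.

Lemma ext_hom_eq (D C : condition S) n m (s : 'I_n -> term S (cvars C))
    (y : 'I_m -> nat) (phi : atoms S ('I_n + 'I_m))
    (h h' : @hom (cond_cat S k) D (ext_cond s y phi)) :
  ext_proj k s y phi \oc h = ext_proj k s y phi \oc h' ->
  (forall j, csub h (new_var _ y j) = csub h' (new_var _ y j)) -> h = h'.
Proof.
move=> /(congr1 (@csub _ _ _ _)) /= eo en; apply/cond_homP/funext => v.
have [[x ->]|[j ->]] := ext_varsP v; last exact: en.
exact: (congr1 (fun f => f x) eo).
Qed.

(** Universal property of the extension: a morphism into it is a morphism to [C] with witnesses for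
    the existential variables that make [phi] hold. Admissibility stays a hypothesis because a
    copairing of injective maps need not be injective. *)
Lemma ext_hom (D C : condition S) n m (s : 'I_n -> term S (cvars C))
    (y : 'I_m -> nat) (phi : atoms S ('I_n + 'I_m))
    (a : @hom (cond_cat S k) D C) (b : 'I_m -> term S (cvars D)) :
  fresh (cvars C) y ->
  (forall h : ext_vars (cvars C) y -> term S (cvars D),
     (forall x, h (old_var y x) = csub a x) ->
     (forall j, h (new_var _ y j) = b j) -> admissible k h) ->
  asubst (fun v => match v with inl i => tsubst (csub a) (s i) | inr j => b j end)
    @` phi `<=` catoms D ->
  exists h : @hom (cond_cat S k) D (ext_cond s y phi),
    ext_proj k s y phi \oc h = a /\ forall j, csub h (new_var _ y j) = b j.
Proof.
move=> yX adm phiD; have [h [ho hn]] := ext_copair (csub a) b yX.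
have hA : asubst h @` catoms (ext_cond s y phi) `<=` catoms D.
  move=> _ [_ [[p Cp <-]|[p phip <-]] <-]; rewrite asubst_comp.
    by apply: (csub_atom (f := a)) => // x; rewrite /= ho.
  apply: phiD; exists p => //; congr asubst.
  apply/funext => -[i|j] /=; last by rewrite hn.
  by rewrite tsubst_comp; congr tsubst; apply/funext => x /=; rewrite ho.
exists (@CondHom S k D (ext_cond s y phi) h (adm h ho hn) hA); split=> //.
by apply/cond_homP/funext => x /=; rewrite ho.
Qed.

Lemma ext_map (D C : condition S) (g : @hom (cond_cat S k) D C) n m
    (s : 'I_n -> term S (cvars C)) (s' : 'I_n -> term S (cvars D))
    (y y' : 'I_m -> nat) (phi : atoms S ('I_n + 'I_m)) :
  fresh (cvars C) y -> fresh (cvars D) y' ->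
  (forall i, s' i = tsubst (csub g) (s i)) ->
  exists h : @hom (cond_cat S k) (ext_cond s' y' phi) (ext_cond s y phi),
    ext_proj k s y phi \oc h = g \oc ext_proj k s' y' phi /\
    forall j, csub h (new_var _ y j) = Var (new_var _ y' j).
Proof.
move=> yX yY s's; apply: ext_hom => // [h ho hn|].
  have gadm := csub_adm g.
  have tv : to_vars (csub g) -> to_vars h.
    move=> gv v; have [[x ->]|[j ->]] := ext_varsP v.
      by have [w e] := gv x; exists (old_var y' w); rewrite ho /= e.
    by exists (new_var _ y' j).
  (* Only [Rn] remains: old variables stay apart since [g] is injective, and the names [y'] are
     distinct and fresh for [D]. *)
  case: (k) g gadm ho tv {s's} => //= g gadm ho tv; last exact: tv.
  case: gadm => gv gI; split; first exact: tv.
  move=> v v'; have [[x ->]|[j ->]] := ext_varsP v;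
    have [[x' ->]|[j' ->]] := ext_varsP v'; rewrite ?ho ?hn.
  - have [w e] := gv x; have [w' e'] := gv x'.
    rewrite e e' => H; have ww := old_var_inj (Var_inj H).
    by congr old_var; apply: gI; rewrite e e' ww.
  - by have [w ->] := gv x => H; case: (old_new_var yY (Var_inj H)).
  - by have [w ->] := gv x' => /esym H; case: (old_new_var yY (Var_inj H)).
  - by move=> H; rewrite (new_var_inj yY (Var_inj H)).
move=> _ [p phip <-]; right; exists p => //; congr asubst.
by apply/funext => -[i|j] //=; rewrite s's tsubst_comp.
Qed.

Lemma ext_isom (D C : condition S) (g : @hom (cond_cat S k) D C) n m
    (s : 'I_n -> term S (cvars C)) (s' : 'I_n -> term S (cvars D))
    (y y' : 'I_m -> nat) (phi : atoms S ('I_n + 'I_m)) :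
  isom g -> fresh (cvars C) y -> fresh (cvars D) y' ->
  (forall i, s' i = tsubst (csub g) (s i)) ->
  exists2 h : @hom (cond_cat S k) (ext_cond s' y' phi) (ext_cond s y phi),
    isom h & ext_proj k s y phi \oc h = g \oc ext_proj k s' y' phi.
Proof.
move=> [g' [gg' g'g]] yX yY s's.
have ss' i : s i = tsubst (csub g') (s' i).
  rewrite s's tsubst_comp -[LHS]tsubst_var; congr tsubst.
  exact: esym (congr1 (@csub _ _ _ _) gg').
have [h [hp hn]] := ext_map phi yX yY s's.
have [h' [hp' hn']] := ext_map phi yY yX ss'.
(* Both composites agree with the identity after projection and on the new variables, which
   determines them. *)
exists h => //; exists h'; split; apply: ext_hom_eq => [|j].
- by rewrite compA hp -compA hp' compA gg' comp1m compm1.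
- by rewrite /= hn /= hn'.
- by rewrite compA hp' -compA hp compA g'g comp1m compm1.
- by rewrite /= hn' /= hn.
Qed.

End Extension.

(** * Refinement, transitivity and pullback stability of the coverage *)

Section Coverage.
Variables (S : signature) (T : coherent_theory S).

Section AnyKind.
Variable k : kind.

Lemma instance_atoms (D C : cond_cat S k) (g : hom D C) (ax : coherent_axiom S)
    (s : 'I_(univ ax) -> term S (cvars C)) :
  atoms_subst s (prem ax) `<=` catoms C ->
  atoms_subst (fun i => tsubst (csub g) (s i)) (prem ax) `<=` catoms D.
Proof.
move=> sA _ [p Pp <-]; rewrite -asubst_comp; apply: (csub_atom (f := g)) => //.
by apply: sA; exists p.
Qed.

Lemma cov_comp_isom (D C : cond_cat S k) (f : hom D C) (V : sink D) :
  isom f -> cov T V -> cov T (postcomp_sink f V).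
Proof.
move=> fI DV; elim: DV C f fI => {D V} [D g gI|D ax s y U Tax sA yD _ IH] C f fI.
  by rewrite /postcomp_sink image_set1; apply: cov_of_isom; apply: isom_comp.
case: (fI) => f' [ff' f'f].
(* The inverse [f'] carries the instance over [D] to one over [C]. *)
pose s' i := tsubst (csub f') (s i).
have s's i : s i = tsubst (csub f) (s' i).
  rewrite tsubst_comp -[LHS]tsubst_var; congr tsubst.
  exact: esym (congr1 (@csub _ _ _ _) f'f).
pose y' (i : 'I_(ndisj ax)) := sval (cid (exists_fresh (cvars C) (exis i))).
have y'C i : fresh (cvars C) (y' i) by rewrite /y'; case: cid.
have hP i := cid2 (ext_isom (concl i) fI (y'C i) (yD i) s's).
rewrite postcomp_sink_bigcup.
(* Going down to [D] and then along [f] equals going along the lifted isomorphism and then down to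
   [C]. *)
rewrite (_ : \bigcup_i _ = \bigcup_i postcomp_sink (ext_proj k s' (y' i) (concl i))
  (postcomp_sink (s2val (hP i)) (U i))); last first.
  by apply: eq_bigcupr => i _; rewrite -!postcomp_sinkM; case: (hP i) => h /= _ ->.
apply: cov_of_axiom => // [|i]; first exact: instance_atoms.
by apply: IH; case: (hP i).
Qed.

Lemma cov_refineT : cov_refine (@cov S T k : cov_rel (cond_cat S k)).
Proof.
move=> C U; elim=> {C U} [C f [f' [ff' _]]|C ax s y U Tax sA yC _ IH] D g.
  (* The identity cover suffices, as [g] factors through the isomorphism [f] by [f' \oc g]. *)
  exists [set ArrowTo (idm D)]; split; first exact/cov_of_isom/isom_idm.
  move=> _ [_ -> <-]; exists f; split=> //; exists (f' \oc g).
  by rewrite compA ff' comp1m [LHS]compm1.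
pose y' (i : 'I_(ndisj ax)) := sval (cid (exists_fresh (cvars D) (exis i))).
have y'D i : fresh (cvars D) (y' i) by rewrite /y'; case: cid.
have hP i := cid (ext_map (concl i) (yC i) (y'D i)
  (fun j => erefl (tsubst (csub g) (s j)))).
have VP i := cid (IH i _ (sval (hP i))).
exists (\bigcup_i postcomp_sink (ext_proj k _ (y' i) (concl i)) (sval (VP i))).
split.
  apply: cov_of_axiom => // [|i]; first exact: instance_atoms.
  by case: (VP i) => V [].
rewrite postcomp_sink_bigcup => v [i _ gv].
have [f [Uf vf]] := refines_square (svalP (hP i)).1 (svalP (VP i)).2 gv.
by exists f; split=> //; exists i.
Qed.

Lemma cov_transT : cov_trans (@cov S T k : cov_rel (cond_cat S k)).
Proof.
move=> C U V CU; elim: CU V => {C U} [C f fI|C ax s y U Tax sA yC _ IH] V UV.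
  by rewrite bigcup_set1; apply: cov_comp_isom => //; apply: UV (erefl f).
rewrite bigcup_bigcup.
rewrite (_ : \bigcup_i _ = \bigcup_i postcomp_sink (ext_proj k s (y i) (concl i))
   (\bigcup_(f in U i) postcomp_sink f (V (postcomp (ext_proj k s (y i) (concl i)) f)))).
  apply: cov_of_axiom => // i.
  (* The family [V] lives on arrows to [C]; it is reindexed along the projection of the
     extension. *)
  apply: (IH i (fun f => V (postcomp _ f))) => f Uf.
  by apply: (UV (postcomp _ f)); exists i => //; exists f.
apply: eq_bigcupr => i _; rewrite bigcup_image postcomp_sink_bigcup.
by apply: eq_bigcupr => f _; rewrite -postcomp_sinkM.
Qed.

Lemma saturated_coverageT :
  saturated_coverage (@cov S T k : cov_rel (cond_cat S k)).
Proof.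
by split; [move=> C f; apply: cov_of_isom|exact: cov_refineT|exact: cov_transT].
Qed.

End AnyKind.

(* For [Rn] this fails: the mediating morphism need not be injective. *)
Lemma ext_pullback (D C : condition S) (g : @hom (C_vs S) D C) n m
    (s : 'I_n -> term S (cvars C)) (s' : 'I_n -> term S (cvars D))
    (y y' : 'I_m -> nat) (phi : atoms S ('I_n + 'I_m)) :
  fresh (cvars C) y -> fresh (cvars D) y' ->
  (forall i, s' i = tsubst (csub g) (s i)) ->
  exists Q : pullback g (ext_proj Vs s y phi),
    ArrowTo (pb_base Q) = ArrowTo (ext_proj Vs s' y' phi).
Proof.
move=> yX yY s's; have [h [hp hn]] := ext_map phi yX yY s's.
have hU (z : C_vs S) (a : hom z D) (b : hom z (ext_cond s y phi)) :
    g \oc a = ext_proj Vs s y phi \oc b ->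
    exists! l, ext_proj Vs s' y' phi \oc l = a /\ h \oc l = b.
  (* The mediating map follows [a] on old variables and [b] on new ones; [phi] holds over [z]
     because [b] already satisfies it. *)
  move=> ab; have [//|f fo fn v|_ [p phip <-]|l [lo ln]] :=
    @ext_hom S Vs z D _ _ s' y' phi a (fun j => csub b (new_var _ y j)).
  - have [[x ->]|[j ->]] := ext_varsP v; first by rewrite fo; apply: (csub_adm a).
    by rewrite fn; apply: (csub_adm b).
  - rewrite (_ : asubst _ p = asubst (csub b) (asubst (inst s y) p)).
      by apply: (csub_atom (f := b)) => //; right; exists p.
    rewrite asubst_comp; congr asubst; apply/funext => -[i|j] //=.
    rewrite s's !tsubst_comp; congr tsubst.
    exact: (congr1 (@csub _ _ _ _) ab).
  exists l; split=> [|l' [lo' lb]]; last first.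
    by apply: ext_hom_eq => [|j]; rewrite ?lo ?lo' // ln -lb /= hn.
  split=> //; apply: ext_hom_eq => [|j]; last by rewrite /= hn /= ln.
  by rewrite compA hp -compA lo.
by exists (Pullback (esym hp) hU).
Qed.

Lemma cov_pullbackT : cov_pullback (@cov S T Vs : cov_rel (C_vs S)).
Proof.
move=> C U; elim=> {C U} [C f fI|C ax s y U Tax sA yC _ IH] D g pb.
  by rewrite image_set1; apply/cov_of_isom/isom_pb_base.
pose y' (i : 'I_(ndisj ax)) := sval (cid (exists_fresh (cvars D) (exis i))).
have y'D i : fresh (cvars D) (y' i) by rewrite /y'; case: cid.
pose s' i := tsubst (csub g) (s i).
suff /(_ _)/cid V i : exists V : @sink (C_vs S) (ext_cond s' (y' i) (concl i)),
    cov T V /\ postcomp_sink (ext_proj Vs s' (y' i) (concl i)) V =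
      [set ArrowTo (pb_base (pb (postcomp (ext_proj Vs s (y i) (concl i)) f)))
        | f in U i].
  rewrite image_bigcup (_ : \bigcup_i _ =
      \bigcup_i postcomp_sink (ext_proj Vs s' (y' i) (concl i)) (sval (V i))).
    apply: cov_of_axiom => // [|i]; first exact: instance_atoms.
    exact: (svalP (V i)).1.
  by apply: eq_bigcupr => i _; rewrite (svalP (V i)).2 /postcomp_sink image_comp.
have [Q] := ext_pullback (concl i) (yC i) (y'D i) (fun j => erefl (s' j)).
(* [QE] equates arrows bundled with their domains, so the goal is phrased through [e'] to replace
   both at once. *)
set e' := ArrowTo (ext_proj _ _ _ _) => QE.
suff: exists V : sink (dom e'), cov T V /\ postcomp_sink e' V =
      [set ArrowTo (pb_base (pb (postcomp (ext_proj Vs s (y i) (concl i)) f)))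
        | f in U i] by [].
rewrite -QE /=.
pose R (f : arrow_to (ext_cond s (y i) (concl i) : C_vs S)) := cid
  (pullback_paste Q (pb (postcomp (ext_proj Vs s (y i) (concl i)) f))).
(* The induction hypothesis is used along [pb_top Q], with the pullbacks supplied by pasting. *)
exists [set ArrowTo (pb_base (sval (R f))) | f in U i]; split; first exact: IH.
by rewrite /postcomp_sink image_comp; apply: eq_imagel => f _; apply: svalP (R f).
Qed.

End Coverage.

(** * Finite limits in [C_vs] *)

(** Variables must be natural numbers, so each class is named by the code of one chosen member;
    related elements have equal classes, hence the same choice. *)
Lemma finite_quotient (T : Type) (R : T -> T -> Prop) :
  finite_set [set: T] -> (forall p, R p p) -> (forall p q, R p q -> R q p) ->
  (forall p q r, R p q -> R q r -> R p r) ->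
  exists (Q : {fset nat}) (f : T -> Q),
    (forall v, exists p, f p = v) /\ (forall p q, f p = f q <-> R p q).
Proof.
move=> finT Rxx Rsym Rtrans.
have /countable_injP[c cI] := finite_set_countable finT.
pose f p := get [set c q | q in R p].
have fP p : exists2 q, R p q & c q = f p.
  by apply: (@getPex _ [set c q | q in R p]); exists (c p); exists p.
have fin_f : finite_set (range f) by apply: finite_image.
have fQ p : f p \in fset_set (range f) by rewrite in_fset_set // inE; exists p.
exists (fset_set (range f)), (fun p => [` fQ p]%fset); split=> [v|p q].
  have := valP v; rewrite in_fset_set // inE => -[p _ pv].
  by exists p; apply: val_inj.
split=> [/(congr1 val) /= fpq|Rpq].
  have [p' Rp ep] := fP p; have [q' Rq eq] := fP q.
  apply: Rtrans Rp _; apply: Rsym.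
  by rewrite (_ : p' = q') //; apply: cI; rewrite ?inE // ep eq.
apply: val_inj; rewrite /= /f; congr (get (c @` _)).
by apply/seteqP; split=> r /=; [apply: Rtrans; apply: Rsym|apply: Rtrans].
Qed.

Section FiniteLimits.
Variables (S : signature) (J : category) (F : functor J (C_vs S)).

Definition diagram_var := {j : J & cvars (F j)}.

(** These are the cocones under the diagram of variable sets. The transition maps appear as a
    relation because [csub] returns terms. *)
Definition diagram_invariant V (h : diagram_var -> V) : Prop :=
  forall (i j : J) (u : hom i j) x z, csub (fmap F u) x = Var z ->
    h (Tagged (fun j : J => cvars (F j) : Type) x) =
    h (Tagged (fun j : J => cvars (F j) : Type) z).

(* The least equivalence relation generated by the transition maps, defined
   impredicatively through the invariant predicates. *)
Definition glued (p q : diagram_var) : Prop :=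
  forall h : diagram_var -> Prop, diagram_invariant h -> h p = h q.

Lemma glued_invariant V (h : diagram_var -> V) p q :
  diagram_invariant h -> glued p q -> h p = h q.
Proof.
(* Invariance under predicates reaches any codomain through the predicate of having the same value
   as [p]. *)
move=> hI /(_ (fun r => h p = h r)) <- // i j u x z e.
by rewrite (hI _ _ _ _ _ e).
Qed.

Lemma finite_diagram_var : finite_category J -> finite_set [set: diagram_var].
Proof.
case=> finJ _; rewrite (_ : [set: diagram_var] =
  \bigcup_j [set Tagged (fun j : J => cvars (F j) : Type) x | x in [set: cvars (F j)]]).
  by apply: bigcup_finite => // j _; apply: finite_image.
by apply/seteqP; split=> // -[j x] _; exists j => //; exists x.
Qed.

Lemma has_limit_vs : finite_category J ->
  exists (c : C_vs S) (p : forall j, hom c (F j)), is_limit p.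
Proof.
move=> finJ.
have [||| Q [f [fsurj fE]]] := @finite_quotient _ glued (finite_diagram_var finJ).
- by [].
- by move=> p q pq h /pq.
- by move=> p q r pq qr h hI; rewrite pq ?qr.
pose g (j : J) (x : cvars (F j)) : term S Q :=
  Var (f (Tagged (fun j : J => cvars (F j) : Type) x)).
have finA : finite_set (\bigcup_j (asubst (g j) @` catoms (F j))).
  by apply: bigcup_finite => [|j _]; [case: finJ|apply/finite_image/atom_fin].
(* The classes are the colimit of the variable sets, and the atoms are the fewest that make every
   projection a morphism. *)
pose c : C_vs S := Condition (Atoms finA).
have gA j : asubst (g j) @` catoms (F j) `<=` catoms c by move=> a ga; exists j.
have gV j : admissible Vs (g j) by move=> x; eexists.
pose p j : hom c (F j) := @CondHom S Vs c (F j) (g j) (gV j) (gA j).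
exists c, p; split=> [i j u|d q qcone].
  apply/cond_homP/funext => x /=; have [z e] := csub_adm (fmap F u) x.
  rewrite e /= /g; congr Var; apply/fE => h hI.
  exact: esym (hI _ _ _ _ _ e).
pose w (r : diagram_var) : term S (cvars d) := csub (q (tag r)) (tagged r).
have wI : diagram_invariant w.
  by move=> i j u x z e; rewrite /w /= -(qcone _ _ u) /= e.
(* A section of the quotient map; [w \o r] does not depend on the representatives because the cone
   [q] is constant on classes. *)
pose r (v : Q) := sval (cid (fsurj v)).
have wr a : w (r (f a)) = w a.
  by apply: glued_invariant wI _; apply/fE; rewrite /r; case: cid.
have hA : asubst (w \o r) @` catoms c `<=` catoms d.
  move=> _ [_ [j _ [a Fa <-]] <-]; rewrite asubst_comp.
  by apply: (csub_atom (f := q j)) => // x; rewrite /= wr.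
have hV : admissible Vs (w \o r) by move=> v; apply: (csub_adm (q _)).
exists (@CondHom S Vs d c (w \o r) hV hA); split=> [j|h hq].
  by apply/cond_homP/funext => x; rewrite /= wr.
(* Uniqueness: every variable of [c] is the image of a variable of some [F j]. *)
apply/cond_homP/funext => v; have [[j x] <-] := fsurj v.
by rewrite /= wr /w /= -hq.
Qed.

End FiniteLimits.

Theorem theorem3p8 (S : signature) (T : coherent_theory S) :
  [/\ saturated_coverage (@cov S T Rn : cov_rel (C_rn S)),
      saturated_coverage (@cov S T Vs : cov_rel (C_vs S)),
      saturated_coverage (@cov S T Ts : cov_rel (C_ts S)) &
      basis (@cov S T Vs : cov_rel (C_vs S))].
Proof.
split; [exact: saturated_coverageT..|split].
  by move=> J finJ F; apply: has_limit_vs.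
split; [by move=> C f; apply: cov_of_isom|exact: cov_pullbackT|exact: cov_transT].
Qed.
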